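(* For each integer $p$ greater than $4$ and each positive real number $\epsilon$, there is a $p$-$\mathrm{col}$-critical graph $G$ such that the ratio of the number of double-$\mathrm{col}$-critical edges of $G$ to the number of all edges of $G$ lies strictly between $1-\epsilon$ and $1$.
   Context: All graphs are finite and simple. The colouring number $\mathrm{col}(G)$ of a non-empty graph $G$ is the smallest integer $k$ for which there is an ordering of the vertices of $G$ such that, when removing the vertices in this order, no vertex of degree more than $k-1$ in the remaining graph is removed at any step; equivalently $\mathrm{col}(G)=\max\{\delta(H) : H \text{ is a (non-empty) induced subgraph of } G\}+1$. The empty graph $K_0$ has colouring number $0$. A graph $G$ is $k$-$\mathrm{col}$-critical if $\mathrm{col}(G)=k$ and $\mathrm{col}(F)<k$ for every proper subgraph $F$ of $G$. For an edge $e=xy$ let $V(e)=\{x,y\}$. An edge $e$ of $G$ is double-$\mathrm{col}$-critical if $\mathrm{col}(G-V(e))\le \mathrm{col}(G)-2$. *)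

(* Defs.v *)
From mathcomp Require Import all_boot.

Set Implicit Arguments.
Unset Strict Implicit.
Unset Printing Implicit Defensive.

(* A finite simple graph whose vertices form a subset of the finite type T; an
   edge is the two-element set V(e) of its ends. *)
Record sgraph (T : finType) := SGraph {
  verts : {set T};
  edges : {set {set T}};
  edges_ok : forall e, e \in edges -> (e \subset verts) && (#|e| == 2)
}.

Section Colouring.
Variable T : finType.
Implicit Types (F G : sgraph T) (S : {set T}).

Definition subgraph F G : bool :=
  (verts F \subset verts G) && (edges F \subset edges G).

Definition proper_subgraph F G : bool := subgraph F G && ~~ subgraph G F.

Definition degree G (x : T) : nat := #|[set e in edges G | x \in e]|.

Lemma delete_ok G S (e : {set T}) :
  e \in [set f in edges G | [disjoint f & S]] ->
  (e \subset verts G :\: S) && (#|e| == 2).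
Proof.
rewrite inE => /andP[eG eS]; have /andP[eV ->] := edges_ok eG.
by rewrite subsetD eV eS.
Qed.

Definition delete G S : sgraph T :=
  @SGraph T (verts G :\: S) [set f in edges G | [disjoint f & S]]
    (@delete_ok G S).

(* "Degree at most k - 1" is stated as "degree < k", so that no non-empty
   graph passes with k = 0 by truncated subtraction, and only the empty graph
   has colouring number 0. *)
Fixpoint removable (k : nat) G (s : seq T) : bool :=
  if s is x :: s' then (degree G x < k) && removable k (delete G [set x]) s'
  else true.

Definition col_le G (k : nat) : bool :=
  has (removable k G) (permutations (enum (verts G))).

Lemma col_le_ex G : exists k, col_le G k.
Proof.
exists #|edges G|.+1; apply/hasP; exists (enum (verts G)).
  by rewrite mem_permutations.
have gen s H : #|edges H| <= #|edges G| -> removable #|edges G|.+1 H s.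
  elim: s H => //= x s IHs H leHG.
  have sub (P : pred {set T}) : #|[set e in edges H | P e]| <= #|edges G|.
    by apply: leq_trans leHG; apply/subset_leq_card/subsetP => e /setIdP[].
  by rewrite ltnS sub IHs //= sub.
exact: gen.
Qed.

Definition col G : nat := ex_minn (col_le_ex G).

Definition col_critical (k : nat) G : Prop :=
  col G = k /\ forall F, proper_subgraph F G -> col F < k.

(* col (G - V(e)) <= col G - 2, written without truncated subtraction. *)
Definition double_col_critical G (e : {set T}) : bool :=
  (e \in edges G) && (col (delete G e) + 2 <= col G).

End Colouring.

(* Main.v *)
Require Import Defs.
From mathcomp Require Import all_boot all_order all_algebra.
From mathcomp Require Import reals zify lra.

Set Implicit Arguments.
Unset Strict Implicit.
Unset Printing Implicit Defensive.

Import Order.TTheory GRing.Theory Num.Theory.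

(** The condition col G <= k says that no non-empty vertex set S induces a graph
    of minimum degree at least k ([col_leP]).  So everything is a question of
    how far a deletion spreads: if D is a set of deleted vertices and S is such
    a set avoiding D, then a vertex that has lost too many neighbours is not in
    S either, and one repeats.

    In a connected r-regular graph the loss of one vertex or edge spreads to the
    whole graph when degree r is asked for, so the graph is critical with
    colouring number r + 1.  An edge vw is double-critical when the deletion of
    v and w spreads to the whole graph under the slower rule that a vertex falls
    once two of its neighbours have fallen; it is not double-critical when v and
    w have no common neighbour, because then nothing falls after them.

    For p = 5 take the square of a long path and close it up with a triangle
    whose six missing edge ends go to the first two and the last two vertices of
    the path ([band]).  This graph is 4-regular and connected.  Along the path,
    two consecutive fallen vertices make the next one fall, so every edge of the
    path square is double-critical ([tail_percolates]), while some edge between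
    the triangle and the path lies in no triangle
    ([band_triangle_free_edge]).

    For larger p, join that graph with m = p - 5 pairwise non-adjacent new
    vertices, the hubs ([join]).  A vertex of the base graph then has degree
    4 + m, and a dense set avoiding the base graph is empty, since hubs alone
    span no edge.  So the base graph decides everything: criticality survives
    ([join_critical]), the status of the base edges does not change
    ([base_double_critical], [base_not_double_critical]), and all the edges at
    the hubs are double-critical ([hub_double_critical]).  A hub must not be
    adjacent to another hub: both have large degree, and the edge between them
    could be deleted for free.

    Only edges at the triangle can thus fail to be double-critical, at least one
    does, and the number of edges tends to infinity with the length of the
    path. *)

(** * Colouring number and dense vertex sets *)

Section Col.
Variable T : finType.
Implicit Types (F G : sgraph T) (D S : {set T}).

Definition inner_degree G S x := #|[set y in S | [set x; y] \in edges G]|.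

Definition dense k G S := {in S, forall x, k <= inner_degree G S x}.

Lemma edge_neq G x y : [set x; y] \in edges G -> x != y.
Proof. by move=> /edges_ok/andP[_]; rewrite cards2; case: (x != y). Qed.

Lemma set2_inj (x y a b : T) :
  [set x; y] = [set a; b] -> (x = a /\ y = b) \/ (x = b /\ y = a).
Proof.
move=> E.
have: x \in [set a; b] by rewrite -E set21.
have: y \in [set a; b] by rewrite -E set22.
have: a \in [set x; y] by rewrite E set21.
have: b \in [set x; y] by rewrite E set22.
rewrite !inE; case/orP=> /eqP-> /orP[]/eqP-> /orP[]/eqP ? /orP[]/eqP ?; auto.
Qed.

Lemma edge_end G f x :
  f \in edges G -> x \in f -> exists y, f = [set x; y].
Proof.
move=> /edges_ok/andP[_ /cards2P[a [b [_ ->]]]]; rewrite !inE.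
by case/orP=> /eqP->; [exists b | exists a; rewrite setUC].
Qed.

(** The neighbours y of x correspond to the edges [set x; y]; counting
    neighbours rather than edges makes it possible to compare degrees in
    different graphs by inclusion of vertex sets. *)
Lemma degreeE G x : degree G x = inner_degree G [set: T] x.
Proof.
rewrite /degree /inner_degree.
rewrite -[RHS](card_in_imset (f := fun y => [set x; y])).
  apply: eq_card => f; rewrite inE; apply/andP/imsetP => [[fG xf]|[y]].
    have [y Ef] := edge_end fG xf.
    by exists y; rewrite ?inE //= -Ef.
  by rewrite !inE /= => xyG ->; rewrite xyG set21.
move=> y z; rewrite !inE /= => /edge_neq xy _ /set2_inj[[] // | [Ez Ey]].
by rewrite Ey eqxx in xy.
Qed.

Lemma inner_degreeS G S S' x :
  S \subset S' -> inner_degree G S x <= inner_degree G S' x.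
Proof.
move=> /subsetP SS'; apply/subset_leq_card/subsetP => y.
by rewrite !inE => /andP[/SS'-> ->].
Qed.

Lemma inner_delete G D S x : x \in S -> [disjoint S & D] ->
  inner_degree (delete G D) S x = inner_degree G S x.
Proof.
move=> xS dSD; apply: eq_card => y; rewrite !inE.
case yS: (y \in S) => //=; case: (_ \in edges G) => //=.
by rewrite disjoints_subset subUset !sub1set !inE !(disjointFr dSD).
Qed.

Lemma dense_delete k G D S :
  [disjoint S & D] -> dense k (delete G D) S <-> dense k G S.
Proof.
by move=> dSD; split=> dS x xS; move: (dS x xS); rewrite inner_delete.
Qed.

(** The first vertex of S to be removed still has all its neighbours in S, hence
    too large a degree. *)
Lemma removable_dense k G s S :
  removable k G s -> dense k G S -> {subset S <= s} -> S = set0.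
Proof.
elim: s G => [|x s IHs] G /=.
  by move=> _ _ S0; apply/setP=> y; rewrite inE; apply/negP=> /S0.
case/andP=> dx rs dS Ss; have xS: x \notin S.
  apply: contraL dx => xS; rewrite -leqNgt degreeE.
  by apply: leq_trans (dS x xS) _; apply: inner_degreeS; apply: subsetT.
apply: IHs rs _ _.
  by apply/dense_delete; rewrite // disjoint_sym disjoints1.
move=> y yS; have := Ss y yS; rewrite inE; case: eqP => // yx.
by rewrite -yx yS in xS.
Qed.

Lemma degree_verts G x : degree G x = inner_degree G (verts G) x.
Proof.
rewrite degreeE; apply: eq_card => y; rewrite !inE /=.
case E: (_ \in edges G); rewrite ?andbF ?andbT //.
have /andP[/subsetP sub _] := edges_ok E.
by rewrite sub // set22.
Qed.

(** Conversely, if no dense set exists then the whole vertex set is not dense, so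
    some vertex of small degree can be removed first, and deletion creates no
    dense set. *)
Lemma col_le_dense k G :
  col_le G k <-> forall S, S \subset verts G -> dense k G S -> S = set0.
Proof.
split=> [/hasP[s]|].
  rewrite mem_permutations => /perm_mem ps rs S sSG dS.
  by apply: removable_dense rs dS _ => x xS; rewrite ps mem_enum (subsetP sSG).
have [n] := ubnP #|verts G|; elim: n G => // n IHn G ltGn noS.
have [V0 | [x xV]] := set_0Vmem (verts G).
  by apply/hasP; exists [::]; rewrite // mem_permutations V0 enum_set0.
have [x0 x0V dx0] : exists2 x, x \in verts G & degree G x < k.
  apply/exists_inP; apply: contraT => /exists_inPn nex.
  suff V0: verts G = set0 by rewrite V0 inE in xV.
  apply: noS => // y yV; rewrite -degree_verts leqNgt; exact: nex.
have /hasP[s ps rs]: col_le (delete G [set x0]) k.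
  apply: IHn => [|S /subsetDP[SG dS] denS].
    by rewrite /= (cardsD1 x0) x0V in ltGn *.
  by apply: noS => //; apply: (proj1 (dense_delete k G dS)) denS.
apply/hasP; exists (x0 :: s); last by rewrite /= dx0.
move: ps; rewrite !mem_permutations /= => ps.
apply: uniq_perm; rewrite ?enum_uniq //=.
  rewrite (perm_uniq ps) enum_uniq andbT (perm_mem ps) mem_enum.
  by rewrite !inE eqxx.
move=> y; rewrite inE (perm_mem ps) !mem_enum !inE.
by case: eqP => // ->.
Qed.

Lemma col_leP k G :
  Defs.col G <= k <-> forall S, S \subset verts G -> dense k G S -> S = set0.
Proof.
rewrite /Defs.col; case: ex_minnP => c cle cmin; split=> [ck S SG dS|noS].
  apply: (proj1 (col_le_dense c G) cle) => // x xS.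
  exact: leq_trans ck (dS x xS).
by apply: cmin; apply/col_le_dense.
Qed.

End Col.

(** * Graphs given by a symmetric relation *)

Section RelGraph.
Variables (T : finType) (e : rel T).
Hypotheses (e_sym : symmetric e) (e_irr : irreflexive e).

Definition rel_edges := [set [set p.1; p.2] | p : T * T & e p.1 p.2].

Lemma rel_edgesP f :
  reflect (exists x y, e x y /\ f = [set x; y]) (f \in rel_edges).
Proof.
apply: (iffP imsetP) => [[[x y]]|[x [y [exy ->]]]].
  by rewrite inE => exy ->; exists x, y.
by exists (x, y); rewrite ?inE.
Qed.

Lemma rel_edges_ok f : f \in rel_edges -> (f \subset [set: T]) && (#|f| == 2).
Proof.
case/rel_edgesP=> x [y [exy ->]]; rewrite subsetT cards2.
by case: (eqVneq x y) exy => [->|] //; rewrite e_irr.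
Qed.

Definition rel_graph : sgraph T := SGraph rel_edges_ok.

Lemma edge_rel_graph x y : ([set x; y] \in edges rel_graph) = e x y.
Proof.
apply/rel_edgesP/idP => [[a [b [eab]]]|exy]; last by exists x, y.
by case/set2_inj=> [[-> ->]|[-> ->]] //; rewrite e_sym.
Qed.

End RelGraph.

(** This turns the degree bound r - 1 into the spreading rule: in an r-regular
    graph a vertex with two neighbours outside A violates it. *)
Lemma two_missing (V : finType) (e : rel V) (A : {set V}) a b c :
  e a b -> e a c -> b != c -> b \notin A -> c \notin A ->
  #|[set w in A | e a w]| + 2 <= #|[set w | e a w]|.
Proof.
move=> eab eac bc bA cA; rewrite -[2]/(true.+1) -bc -cards2 -cardsUI.
rewrite [X in _ + X](_ : _ = 0) ?addn0.
  apply/subset_leq_card/subsetP=> w; rewrite !inE.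
  by case/orP=> [/andP[]//|/orP[]/eqP->].
apply/eqP; rewrite cards_eq0; apply/eqP/setP=> w; rewrite !inE.
by apply/negP=> /andP[/andP[wA _] /orP[]/eqP E]; move: wA; apply/negP; rewrite E.
Qed.

(** * Joining a regular graph with independent hubs *)

Section Join.
Variables (V : finType) (e : rel V) (m r : nat).
Hypotheses (e_sym : symmetric e) (e_irr : irreflexive e).
Hypothesis e_reg : forall v, #|[set w | e v w]| = r.
Hypothesis e_conn : forall A : {set V},
  A != set0 -> (forall a b, a \in A -> e a b -> b \in A) -> A = [set: V].
(* The hubs have degree #|V|; the last condition makes it at least the degree
   r + m of the base vertices, which is then the minimum degree. *)
Hypotheses (r_gt1 : 1 < r) (V_big : r + m <= #|V|).

Definition join_rel : rel (V + 'I_m) := fun x y =>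
  match x, y with
  | inl v, inl w => e v w
  | inr _, inr _ => false
  | _, _ => true
  end.

Lemma join_sym : symmetric join_rel.
Proof. by case=> [v|k] [w|l] //=. Qed.

Lemma join_irr : irreflexive join_rel.
Proof. by case=> [v|k] /=. Qed.

Definition join : sgraph (V + 'I_m)%type := rel_graph join_irr.

Implicit Types (F : sgraph (V + 'I_m)%type) (S : {set V + 'I_m}) (A : {set V}).

Definition base S : {set V} := [set v | inl v \in S].
Definition hubs S : {set 'I_m} := [set k | inr k \in S].

Lemma edge_join x y : ([set x; y] \in edges join) = join_rel x y.
Proof. exact: edge_rel_graph join_sym _ _ _. Qed.

Lemma inner_join_base S v : inner_degree join S (inl v) =
  #|[set w in base S | e v w]| + #|hubs S|.
Proof.
rewrite /inner_degree -!sum1_card big_sumType /=; congr (_ + _);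
  by apply: eq_bigl => y; rewrite !inE edge_join ?andbT.
Qed.

Lemma inner_join_hub S k : inner_degree join S (inr k) = #|base S|.
Proof.
rewrite /inner_degree -!sum1_card big_sumType /= [X in _ + X]big_pred0 ?addn0.
  by apply: eq_bigl => y; rewrite !inE edge_join ?andbT.
by move=> y; rewrite !inE edge_join andbF.
Qed.

Lemma dense_sub F S k : subgraph F join -> dense k F S -> dense k join S.
Proof.
case/andP=> _ /subsetP FJ dS x xS; apply: leq_trans (dS x xS) _.
by apply/subset_leq_card/subsetP => y; rewrite !inE /= => /andP[-> /FJ].
Qed.

(** Hubs are adjacent to base vertices only, so without base vertices they have
    degree 0. *)
Lemma dense_hubs k S : 0 < k -> dense k join S -> base S = set0 -> S = set0.
Proof.
move=> k0 dS bS0; have noV v : inl v \notin S.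
  by have := in_set0 v; rewrite -bS0 inE => ->.
apply/setP=> -[v|l]; rewrite inE ?(negPf (noV v)) //.
by apply/negP=> /dS; rewrite inner_join_hub bS0 cards0 leqNgt k0.
Qed.

Lemma card_hubs S : #|hubs S| <= m.
Proof. by rewrite -[leqRHS]card_ord max_card. Qed.

(** At most m of the neighbours of a base vertex are hubs. *)
Lemma dense_base k S : dense (k + m) join S ->
  {in base S, forall v, k <= #|[set w in base S | e v w]|}.
Proof.
move=> dS v; rewrite inE => /dS; rewrite inner_join_base.
have := card_hubs S; lia.
Qed.

Lemma base_degree A v : #|[set w in A | e v w]| <= r.
Proof.
rewrite -(e_reg v); apply/subset_leq_card/subsetP => w.
by rewrite !inE => /andP[].
Qed.

(** In a set of minimum degree r all neighbours of a member are members, so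
    connectedness applies. *)
Lemma full_degree A :
  {in A, forall v, r <= #|[set w in A | e v w]|} -> A != set0 -> A = [set: V].
Proof.
move=> dA A0; apply: e_conn A0 _ => a b aA eab.
have/eqP E: [set w in A | e a w] == [set w | e a w].
  rewrite eqEcard e_reg dA // andbT; apply/subsetP=> w.
  by rewrite !inE => /andP[].
by have := in_set (e a) b; rewrite -E inE eab => /andP[].
Qed.

Lemma inner_full v : inner_degree join [set: _] (inl v) = r + m.
Proof.
rewrite inner_join_base -(e_reg v); congr (_ + _).
  by apply: eq_card => w; rewrite !inE.
by rewrite -[RHS]card_ord; apply: eq_card => k; rewrite !inE.
Qed.

Lemma col_join : Defs.col join = (r + m).+1.
Proof.
apply/eqP; rewrite eqn_leq; apply/andP; split.
  apply/col_leP => S _ dS; apply: dense_hubs (dS) _ => //.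
  apply/setP=> v; rewrite [RHS]inE; apply/negP=> vS.
  have := dense_base (k := r.+1) dS vS; have := base_degree (base S) v; lia.
rewrite ltnNge; apply/negP=> /col_leP noS.
suff S0 : [set: V + 'I_m] = set0.
  have /card_gt0P[v _] : 0 < #|V| by lia.
  by have := in_setT (inl v : V + 'I_m); rewrite S0 inE.
apply: noS => // -[v|k] _; first by rewrite inner_full.
rewrite inner_join_hub; apply: leq_trans V_big _.
by rewrite -cardsT; apply/subset_leq_card/subsetP=> v; rewrite !inE.
Qed.

(** A dense set of a subgraph F leaves no room for the loss of a neighbour at a
    base vertex, so it contains everything and F has every edge at a base
    vertex.  These are all the edges because the hubs are independent. *)
Lemma join_critical : col_critical (r + m).+1 join.
Proof.
split=> [|F /andP[FJ JF]]; first exact: col_join.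
rewrite ltnS; apply/col_leP => S SF dF.
have dS := dense_sub FJ dF; apply: dense_hubs (dS) _; first by lia.
apply: contraNeq JF => bS0; have bST := full_degree (dense_base dS) bS0.
have vS v : inl v \in S by have := in_setT v; rewrite -bST inE.
(* Equal degrees force the neighbourhoods of v in F and in the join to agree. *)
have allF v y : join_rel (inl v) y -> (y \in S) && ([set inl v; y] \in edges F).
  rewrite -edge_join => vy.
  have /eqP E: [set y in S | [set inl v; y] \in edges F]
             == [set y in [set: _] | [set inl v; y] \in edges join].
    rewrite eqEcard; apply/andP; split.
      case/andP: FJ => _ /subsetP FJ.
      by apply/subsetP=> z; rewrite !inE /= => /andP[_ /FJ].
    by move: (dF _ (vS v)); rewrite -[r + m](inner_full v).
  by have := in_set (fun y => [set inl v; y] \in edges join) y;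
     move/setP/(_ y): E; rewrite !inE /= vy.
have ST : S = [set: _].
  have /set0Pn[v _] := bS0.
  apply/setP=> -[w|k]; rewrite inE ?vS //.
  by have /andP[] := allF v (inr k) isT.
apply/andP; split; first by rewrite -[verts join]/[set: _] -ST.
apply/subsetP=> f /rel_edgesP[x [y [xy ->]]].
case: x y xy => [v|k] [w|l] xy //; first by case/andP: (allF _ _ xy).
  by case/andP: (allF _ _ xy).
by rewrite setUC; case/andP: (allF w (inr k) isT).
Qed.

Lemma double_criticalP f : f \in edges join ->
  double_col_critical join f <->
  forall S, [disjoint S & f] -> dense (r.-1 + m) join S -> S = set0.
Proof.
move=> fJ; rewrite /double_col_critical fJ col_join /=.
have -> : (Defs.col (delete join f) + 2 <= (r + m).+1)
   = (Defs.col (delete join f) <= r.-1 + m) by lia.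
split=> [/col_leP noS S dSf dS | noS].
  apply: noS; first by rewrite subsetD subsetT.
  exact: (proj2 (dense_delete _ _ dSf)) dS.
apply/col_leP=> S /subsetDP[_ dSf] dS; apply: noS => //.
exact: (proj1 (dense_delete _ _ dSf)) dS.
Qed.

(** With one hub gone, the other hubs account for at most m - 1 neighbours, so a
    base vertex of S keeps all its r neighbours in the base; by connectedness S
    contains the whole base, including the deleted v. *)
Lemma hub_double_critical v k : double_col_critical join [set inl v; inr k].
Proof.
apply/double_criticalP; first by rewrite edge_join.
move=> S dSf dS; apply: dense_hubs (dS) _; first by lia.
apply/eqP/negPn/negP=> bS0.
have kS : inr k \notin S by rewrite (disjointFl dSf) // set22.
suff bST: base S = [set: V].
  have := in_setT v; rewrite -bST inE; apply/negP.
  by rewrite (disjointFl dSf) // set21.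
apply: full_degree bS0 => w; rewrite inE => /dS; rewrite inner_join_base.
suff: #|hubs S| < m by lia.
rewrite -[ltnRHS]card_ord -cardsT proper_card // properE subsetT /=.
by apply/subsetPn; exists k; rewrite !inE.
Qed.

(** The next two lemmas reduce the status of a base edge to the base graph: the
    base part of a dense set has minimum degree r - 1, and conversely adding
    all hubs to a base set of minimum degree r - 1 gives a dense set. *)
Lemma base_double_critical v w : e v w ->
  (forall A, v \notin A -> w \notin A ->
     {in A, forall a, r.-1 <= #|[set b in A | e a b]|} -> A = set0) ->
  double_col_critical join [set inl v; inl w].
Proof.
move=> evw noA; apply/double_criticalP; first by rewrite edge_join.
move=> S dSf dS; apply: dense_hubs (dS) _; first by lia.
apply: noA (dense_base dS); rewrite inE (disjointFl dSf) //.
  exact: set21.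
exact: set22.
Qed.

Lemma base_not_double_critical v w A : e v w -> v \notin A -> w \notin A ->
  {in A, forall a, r.-1 <= #|[set b in A | e a b]|} -> r.-1 + m <= #|A| ->
  ~~ double_col_critical join [set inl v; inl w].
Proof.
move=> evw vA wA dA bigA; apply/negP=> /double_criticalP.
rewrite edge_join => /(_ evw) noS.
pose S : {set V + 'I_m} := [set x | if x is inl a then a \in A else true].
have bS : base S = A by apply/setP=> a; rewrite !inE.
have S0 : S = set0.
  apply: noS => [|[a|k]].
  - rewrite disjoint_sym disjoints_subset subUset !sub1set !inE vA wA //.
  - rewrite inE inner_join_base bS => aA; rewrite leq_add ?dA //.
    by rewrite -[leqLHS]card_ord; apply/subset_leq_card/subsetP=> k; rewrite !inE.
  by rewrite inner_join_hub bS.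
have A0 : A = set0 by rewrite -bS S0; apply/setP=> a; rewrite !inE.
by move: bigA; rewrite A0 cards0; lia.
Qed.

(** Every base vertex lies in an edge, and an edge covers two vertices. *)
Lemma card_join_edges : #|V| <= 2 * #|edges join|.
Proof.
have: #|cover (edges join)| <= \sum_(f in edges join) #|f| := leq_card_cover _.
rewrite (eq_bigr (fun=> 2)) => [|f /edges_ok/andP[_ /eqP] //].
rewrite sum_nat_const mulnC; apply: leq_trans.
rewrite -(card_imset _ (@inl_inj V 'I_m)); apply/subset_leq_card/subsetP=> x.
case/imsetP=> v _ ->; have /card_gt0P[w] : 0 < #|[set w | e v w]|.
  by rewrite e_reg; lia.
rewrite inE => evw; apply/bigcupP; exists [set inl v; inl w]; last exact: set21.
by rewrite edge_join.
Qed.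

(** An edge that is not double-critical is a base edge with an end in L, and each
    vertex of L is on r base edges. *)
Lemma double_critical_count (L : {set V}) :
  (forall v w, v \notin L -> w \notin L -> e v w ->
     double_col_critical join [set inl v; inl w]) ->
  #|edges join| <= #|[set f | double_col_critical join f]| + #|L| * r.
Proof.
move=> dcL; pose P := [set p : V * V | (p.1 \in L) && e p.1 p.2].
have <-: #|P| = #|L| * r.
  rewrite -sum1dep_card -(pair_big_dep (mem L) e (fun _ _ => 1)) /=.
  rewrite (eq_bigr (fun=> r)) ?sum_nat_const // => v _.
  by rewrite sum1dep_card e_reg.
pose g (p : V * V) : {set V + 'I_m} := [set inl p.1; inl p.2].
apply: leq_trans (_ : #|[set f | double_col_critical join f] :|: g @: P| <= _).
  apply/subset_leq_card/subsetP=> f /rel_edgesP[x [y [xy ->]]]; rewrite !inE.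
  case: x y xy => [v|k] [w|l] xy //.
  - have [vL|vL] := boolP (v \in L).
      by apply/orP; right; apply/imsetP; exists (v, w); rewrite ?inE ?vL.
    have [wL|wL] := boolP (w \in L); last by rewrite dcL.
    apply/orP; right; apply/imsetP; exists (w, v); last by rewrite setUC.
    by rewrite inE wL e_sym.
  - by rewrite hub_double_critical.
  by rewrite setUC hub_double_critical.
by rewrite (leq_trans (leq_card_setU _ _)) // leq_add2l leq_imset_card.
Qed.

End Join.

(** * The base graph: a path square closed up with a triangle *)

Section Band.
Variable n : nat.

(** The vertices from 3 to n - 1 form the square of a path, whose end vertices 3
    and n - 1 lack two neighbours and whose vertices 4 and n - 2 lack one.  The
    triangle 0, 1, 2 supplies them: 0 gets 4 and n - 1, 1 gets 3 and n - 1,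
    2 gets 3 and n - 2. *)
Definition band_nbrs (i : nat) : seq nat :=
  if i == 0 then [:: 1; 2; 4; n - 1] else
  if i == 1 then [:: 0; 2; 3; n - 1] else
  if i == 2 then [:: 0; 1; 3; n - 2] else
  if i == 3 then [:: 1; 2; 4; 5] else
  if i == 4 then [:: 0; 3; 5; 6] else
  if i == n - 2 then [:: 2; n - 4; n - 3; n - 1] else
  if i == n - 1 then [:: 0; 1; n - 3; n - 2] else
  [:: i - 2; i - 1; i + 1; i + 2].

Definition band : rel 'I_n := fun i j => nat_of_ord j \in band_nbrs i.

Hypothesis n_big : 8 < n.

Local Ltac table := rewrite /band_nbrs; do ?case: ifP; rewrite ?inE; lia.

Lemma band_nbrs_sym i j : i < n -> j < n -> i \in band_nbrs j -> j \in band_nbrs i.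
Proof. rewrite /band_nbrs; do ?case: ifP; rewrite ?inE; lia. Qed.

Lemma band_nbrs_irr i : i \notin band_nbrs i.
Proof. table. Qed.

Lemma band_nbrs_uniq i : i < n -> uniq (band_nbrs i).
Proof. by rewrite /band_nbrs; do ?case: ifP => /=; rewrite ?inE; lia. Qed.

Lemma band_nbrs_lt i j : i < n -> j \in band_nbrs i -> j < n.
Proof. table. Qed.

Lemma band_nbrs_size i : size (band_nbrs i) = 4.
Proof. by rewrite /band_nbrs; do ?case: ifP. Qed.

Lemma band_nbrs_next i : i.+1 < n -> i.+1 \in band_nbrs i.
Proof. table. Qed.

(** Together with [band_nbrs_next] this gives the square of a path on all labels
    0, ..., n - 1, up to the missing pair 2, 4. *)
Lemma band_nbrs_next2 i : i != 2 -> i.+2 < n -> i.+2 \in band_nbrs i.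
Proof. table. Qed.

Lemma band_nbrs_tail i j : i < n -> 2 < i -> i < j -> j \in band_nbrs i ->
  j = i.+1 \/ j = i.+2.
Proof. table. Qed.

Lemma band_nbrs_04 i : i < n -> ~~ ((0 \in band_nbrs i) && (4 \in band_nbrs i)).
Proof. table. Qed.

Lemma band_nbrs_2 : n - 2 \in band_nbrs 2.
Proof. table. Qed.

Lemma band_sym : symmetric band.
Proof. by move=> i j; apply/idP/idP; apply: band_nbrs_sym. Qed.

Lemma band_irr : irreflexive band.
Proof. by move=> i; apply/negbTE/band_nbrs_irr. Qed.

Lemma band_regular i : #|[set j | band i j]| = 4.
Proof.
rewrite cardE -(size_map val) -(band_nbrs_size i); apply/perm_size/uniq_perm.
- by rewrite map_inj_uniq ?enum_uniq //; apply: val_inj.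
- exact: band_nbrs_uniq.
move=> j; apply/mapP/idP => [[k]|ji]; first by rewrite mem_enum inE => ki ->.
by exists (Ordinal (band_nbrs_lt (ltn_ord i) ji)); rewrite ?mem_enum ?inE.
Qed.

(** Consecutive labels are adjacent, so the graph has a Hamiltonian path. *)
Lemma band_connected (A : {set 'I_n}) : A != set0 ->
  (forall i j, i \in A -> band i j -> j \in A) -> A = [set: 'I_n].
Proof.
case/set0Pn=> i iA clA; apply/setP=> j; rewrite inE.
have up d (k : 'I_n) : nat_of_ord k = i + d -> k \in A.
  elim: d k => [|d IHd] k Ek.
    by rewrite (_ : k = i) //; apply: val_inj; rewrite /= Ek addn0.
  have ltd : i + d < n by have := ltn_ord k; lia.
  apply: clA (IHd (Ordinal ltd) erefl) _.
  by rewrite /band Ek addnS band_nbrs_next // -addnS -Ek.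
have down d (k : 'I_n) : nat_of_ord k = i - d -> k \in A.
  elim: d k => [|d IHd] k Ek.
    by rewrite (_ : k = i) //; apply: val_inj; rewrite /= Ek subn0.
  have ltd : i - d < n by have := ltn_ord i; lia.
  have IH := IHd (Ordinal ltd) erefl.
  case: (ltnP d i) => di; last first.
    by rewrite (_ : k = Ordinal ltd) //; apply: val_inj; rewrite /= Ek; lia.
  apply: clA IH _; rewrite band_sym /band /= (_ : i - d = k.+1); last by lia.
  by apply: band_nbrs_next; lia.
case: (leqP i j) => ij; first by apply: (up (j - i)); lia.
by apply: (down (i - j)); lia.
Qed.

Section Percolation.
Variable A : {set 'I_n}.
Hypothesis dA : {in A, forall i, 3 <= #|[set j in A | band i j]|}.

(** Stated for a natural number, and vacuous beyond n, so that arithmetic on the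
    labels needs no bound proofs. *)
Definition out i := forall j : 'I_n, nat_of_ord j = i -> j \notin A.

Lemma out_step a b c : b < n -> c < n -> b != c ->
  b \in band_nbrs a -> c \in band_nbrs a -> out b -> out c -> out a.
Proof.
move=> bn cn bc ba ca ob oc i Ei; apply/negP=> iA.
suff: #|[set j in A | band i j]| + 2 <= 4 by have := dA iA; lia.
rewrite -(band_regular i); apply: (@two_missing _ _ _ _ (Ordinal bn) (Ordinal cn));
  rewrite /band ?Ei //; [exact: ob | exact: oc].
Qed.

(** Two consecutive missing vertices spread upwards to n - 1 and downwards to 0,
    the vertex a falling because of a - 2 and a - 1, or of a + 1 and a + 2. *)
Lemma percolation v : 2 < v -> v.+1 < n -> out v -> out v.+1 -> A = set0.
Proof.
move=> v2 vn ov ov1.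
have up d : v + d.+1 < n -> out (v + d) /\ out (v + d.+1).
  elim: d => [|d IHd] dn; first by rewrite addn0 addn1.
  have [|o1 o2] := IHd; first by lia.
  split=> //; apply: out_step o1 o2; try lia; apply: band_nbrs_sym; try lia.
    by rewrite !addnS band_nbrs_next2 //; lia.
  by rewrite [v + d.+2]addnS band_nbrs_next //; lia.
have upn j : v <= j -> j < n -> out j.
  move=> vj jn; have [->|ne] := eqVneq j v; first by [].
  have E : v + (j - v.+1).+1 = j by lia.
  by have := up (j - v.+1); rewrite E => /(_ jn)[].
have down d : d <= v -> out (v - d) /\ out (v - d).+1.
  elim: d => [|d IHd] dv; first by rewrite subn0.
  have [|o1 o2] := IHd; first by lia.
  have E : v - d = (v - d.+1).+1 by lia.
  rewrite E in o1 o2; split=> //; have [v3|ne2] := eqVneq (v - d.+1) 2.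
    (* 2 is not adjacent to 4, but to n - 2, which is out by the upward part. *)
    rewrite v3 in o1 *; apply: (@out_step _ 3 (n - 2));
      rewrite ?band_nbrs_2 ?band_nbrs_next //; try lia.
    by case: (leqP v (n - 2)) => vn2; [apply: upn; lia | lia].
  by apply: out_step o1 o2; rewrite ?band_nbrs_next ?band_nbrs_next2 //; lia.
apply/setP=> j; rewrite inE; apply/negbTE; case: (leqP v j) => vj.
  exact: (upn j).
by have [] := down (v - j); [lia | move=> o _; apply: o; lia].
Qed.

End Percolation.

(** If w = v + 2, the common neighbour v + 1 falls first. *)
Lemma tail_percolates (v w : 'I_n) (A : {set 'I_n}) :
  2 < v -> 2 < w -> band v w -> v \notin A -> w \notin A ->
  {in A, forall i, 3 <= #|[set j in A | band i j]|} -> A = set0.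
Proof.
move=> v2 w2 vw vA wA dA.
wlog ltvw : v w v2 w2 vw vA wA / v < w.
  move=> W; case: (ltngtP v w) => [vltw|wltv|/val_inj E].
  - exact: (W v w).
  - by apply: (W w v) => //; rewrite band_sym.
  by rewrite E band_irr in vw.
have ov : out A v by move=> i /val_inj->.
have ow : out A w by move=> i /val_inj->.
have wn := ltn_ord w.
case: (band_nbrs_tail (ltn_ord v) v2 ltvw vw) => Ew; rewrite Ew in ow wn.
  exact: percolation ov ow.
apply: (percolation dA) (ov) _ => //; first by lia.
apply: (out_step dA) ow ov; try lia; first by rewrite band_nbrs_next.
by apply: band_nbrs_sym; rewrite ?band_nbrs_next //; lia.
Qed.

(** The edge from 0 to 4 lies in no triangle, so every vertex loses at most one of
    its four neighbours. *)
Lemma band_triangle_free_edge (v w i : 'I_n) :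
  nat_of_ord v = 0 -> nat_of_ord w = 4 ->
  3 <= #|[set j in ~: [set v; w] | band i j]|.
Proof.
move=> v0 w4.
rewrite -ltnS -(band_regular i) -(cardsID [set v; w] [set j | band i j]) addnC.
rewrite -addn1 leq_add //.
  by apply/subset_leq_card/subsetP=> j; rewrite !inE.
rewrite leqNgt; apply/negP=> gt1.
suff: [set v; w] \subset [set j | band i j].
  rewrite subUset !sub1set !inE /band v0 w4; apply/negP/band_nbrs_04; exact: ltn_ord.
have: [set j | band i j] :&: [set v; w] == [set v; w].
  rewrite eqEcard subsetIr /=; apply: leq_trans gt1.
  by rewrite cards2; case: (_ != _).
by move/eqP<-; apply: subsetIl.
Qed.

End Band.

(** * Letting the path grow *)

Lemma card_ord_lt n k : #|[set i : 'I_n | i < k]| <= k.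
Proof.
rewrite -[leqRHS](size_iota 0) cardE -(size_map val).
apply: uniq_leq_size; first by rewrite map_inj_uniq ?enum_uniq //; apply: val_inj.
by move=> _ /mapP[i iL ->]; rewrite mem_iota; move: iL; rewrite mem_enum inE.
Qed.

Local Open Scope ring_scope.

Theorem proposition24 (R : realType) (p : nat) (eps : R)
    (hp : (4 < p)%N) (heps : 0 < eps) :
  exists (T : finType) (G : sgraph T),
    col_critical p G /\
    1 - eps < (#|[set e | double_col_critical G e]|%:R / #|edges G|%:R : R) < 1.
Proof.
pose m := (p - 5)%N.
(* At most 12 edges fail and there are at least n / 2 edges, so n > 24 / eps is
   needed; the other summands give room for the hubs and the table [band_nbrs]. *)
pose n := ((Num.truncn (24 / eps)).+1 + p + 9)%N.
have n_big : (8 < n)%N by rewrite /n; lia.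
have V_big : (4 + m <= #|'I_n|)%N by rewrite card_ord /n /m; lia.
pose irr := band_irr n_big.
exists ('I_n + 'I_m)%type, (join m irr).
have sym := band_sym n_big; have reg := band_regular n_big.
have conn := band_connected n_big.
split.
  have -> : p = (4 + m).+1 by rewrite /m; lia.
  exact: join_critical.
set D := [set e | _]; set E := edges _.
have count : (#|E| <= #|D| + 12)%N.
  (* The triangle 0, 1, 2: three vertices, each on four base edges. *)
  pose L := [set i : 'I_n | (i < 3)%N].
  have := leq_mul (card_ord_lt n 3) (leqnn 4).
  have: (#|E| <= #|D| + #|L| * 4)%N; last by rewrite /L; lia.
  apply: double_critical_count => // v w; rewrite !inE -!leqNgt => v2 w2 vw.
  apply: base_double_critical => // A; exact: tail_percolates.
have ltDE : (#|D| < #|E|)%N.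
  apply: proper_card; apply/properP; split.
    by apply/subsetP=> f; rewrite inE => /andP[].
  have n0 : (0 < n)%N by lia.
  have n4 : (4 < n)%N by lia.
  pose v := Ordinal n0; pose w := Ordinal n4.
  exists [set inl v; inl w]; first by rewrite edge_join.
  rewrite inE; apply: (base_not_double_critical sym irr reg _ V_big (A := ~: [set v; w])) => //.
  - by rewrite !inE eqxx.
  - by rewrite !inE eqxx orbT.
  - by move=> i _; apply: band_triangle_free_edge.
  have := cardsC [set v; w]; rewrite cards2 card_ord /= /n /m; lia.
have nE : (n <= 2 * #|E|)%N by rewrite -[leqLHS]card_ord; apply: card_join_edges.
have E0 : 0 < #|E|%:R :> R by rewrite ltr0n; lia.
rewrite ltr_pdivlMr // ltr_pdivrMr // mul1r ltr_nat ltDE andbT.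
have : 24 < eps * n%:R.
  rewrite mulrC -ltr_pdivrMr //; apply: lt_le_trans (truncnS_gt _) _.
  by rewrite ler_nat /n -addnA leq_addr.
have : eps * n%:R <= eps * (2 * #|E|%:R) by rewrite ler_pM2l // -natrM ler_nat.
have : #|E|%:R <= #|D|%:R + 12 :> R by rewrite -natrD ler_nat.
lra.
Qed.
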